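(* Consider a node $\mathcal I$ of a model tree, with children $\mathcal I\cdot m$, $m=1,\dots,M^{\mathcal I}$, and the general control variate relation for the total variate at that node, $$Z^{\mathcal I} = h\left(X^{\mathcal I}\right) - \sum_{m=1}^{M^{\mathcal I}} S^{\mathcal I\cdot m}\left[g^{\mathcal I\cdot m}\big(\widehat U^{\mathcal I\cdot m}\big) - g^{\mathcal I\cdot m}\big(U^{\mathcal I\cdot m}\big)\right],$$ where $X^{\mathcal I}$ is the principal variate, $\widehat U^{\mathcal I\cdot m}$ are the control variates, $U^{\mathcal I\cdot m}$ are the ancillary variates, and the matrices $S^{\mathcal I\cdot m}$ are the gains. Suppose that all the control variates $\widehat U^{\mathcal I\cdot m}$, $m=1,\dots,M^{\mathcal I}$, are highly correlated to the principal variate $X^{\mathcal I}$ and to each other, and that all the ancillary variates $U^{\mathcal I\cdot m}$, $m=1,\dots,M^{\mathcal I}$, are independent of each other and of the variates on the same fidelity and above. Then the set of optimal gains is defined by the linear system $$\begin{bmatrix} S^{\mathcal I\cdot 1} & \cdots & S^{\mathcal I\cdot M^{\mathcal I}}\end{bmatrix} \begin{bmatrix} \Sigma_{g(\widehat U^{\mathcal I\cdot 1})}+\Sigma_{g(U^{\mathcal I\cdot 1})} & \cdots & \Sigma_{g(\widehat U^{\mathcal I\cdot 1}),\,g(\widehat U^{\mathcal I\cdot M^{\mathcal I}})}\\ \vdots & \ddots & \vdots\\ \Sigma_{g(\widehat U^{\mathcal I\cdot M^{\mathcal I}}),\,g(\widehat U^{\mathcal I\cdot 1})} & \cdots & \Sigma_{g(\widehat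 U^{\mathcal I\cdot M^{\mathcal I}})}+\Sigma_{g(U^{\mathcal I\cdot M^{\mathcal I}})} \end{bmatrix} =\begin{bmatrix}\Sigma_{h(X^{\mathcal I}),\,g(\widehat U^{\mathcal I\cdot 1})} & \cdots & \Sigma_{h(X^{\mathcal I}),\,g(\widehat U^{\mathcal I\cdot M^{\mathcal I}})}\end{bmatrix},$$ where $g(\widehat U^{\mathcal I\cdot m})$ and $g(U^{\mathcal I\cdot m})$ abbreviate $g^{\mathcal I\cdot m}(\widehat U^{\mathcal I\cdot m})$ and $g^{\mathcal I\cdot m}(U^{\mathcal I\cdot m})$.
   Context: A model tree is a rooted tree whose nodes are simulation models. The root is the high fidelity model, and the children of a node are lower fidelity surrogates of the model at that node. Nodes are indexed by tuples: node $\mathcal I$ has $M^{\mathcal I}$ children $\mathcal I\cdot 1,\dots,\mathcal I\cdot M^{\mathcal I}$, where $\cdot$ denotes tuple concatenation. The principal variate $X^{\mathcal I}$ is a random vector representing the state of the model at node $\mathcal I$. To each child $\mathcal I\cdot m$ corresponds a pair of random vectors $(\widehat U^{\mathcal I\cdot m},U^{\mathcal I\cdot m})$, the control and ancillary variates, describing the information about that surrogate model. If the child $\mathcal I\cdot m$ itself has children, its ancillary variate is the total variate of the subtree rooted at it, $U^{\mathcal I\cdot m}:=Z^{\mathcal I\cdot m}$, defined recursively by the same relation. The functions $h$ and $g^{\mathcal I\cdot m}$ are given and possibly non-linear. $\Sigma_{A,B}$ denotes the covariance between random vectors $A$ and $B$, and $\Sigma_A=\Sigma_{A,A}$. Gains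 are optimal if they minimize the trace generalized variance $\operatorname{tr}(\Sigma_{Z^{\mathcal I},Z^{\mathcal I}})$ of the total variate. *)

(* Defs.v *)
From HB Require Import structures.
From mathcomp Require Import all_boot all_order all_algebra.
From mathcomp Require Import all_classical all_reals all_analysis.

Set Implicit Arguments.
Unset Strict Implicit.
Unset Printing Implicit Defensive.

Import Order.TTheory GRing.Theory Num.Theory.
Import numFieldNormedType.Exports.

Local Open Scope classical_set_scope.
Local Open Scope ring_scope.

(* Product (= Borel) sigma-algebra on R^n, generated by the coordinates; it is
   built as the library does for n.-tuple T. *)
Section measurable_cV.
Context {R : realType} (n : nat).

Let coor : 'I_n -> 'cV[R]_n -> R := fun i v => v i 0.

Let cV_set0 : g_sigma_preimage coor set0.
Proof. exact: sigma_algebra0. Qed.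

Let cV_setC A : g_sigma_preimage coor A -> g_sigma_preimage coor (~` A).
Proof. exact: sigma_algebraC. Qed.

Let cV_bigcup (F : _^nat) : (forall i, g_sigma_preimage coor (F i)) ->
  g_sigma_preimage coor (\bigcup_i (F i)).
Proof. exact: sigma_algebra_bigcup. Qed.

HB.instance Definition _ := @isMeasurable.Build default_measure_display
  'cV[R]_n (g_sigma_preimage coor) cV_set0 cV_setC cV_bigcup.

End measurable_cV.

Section random_vectors.
Context {d : measure_display} {T : measurableType d} {R : realType}.
Variable P : probability T R.

Definition square_integrable n (A : T -> 'cV[R]_n) : Prop :=
  forall i, (fun t => A t i 0) \in Lfun P 2%:E.

(* Sigma_{A,B} *)
Definition covmx p q (A : T -> 'cV[R]_p) (B : T -> 'cV[R]_q) : 'M[R]_(p, q) :=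
  \matrix_(i, j) fine (covariance P (fun t => A t i 0) (fun t => B t j 0)).

Definition linear_comb n (a : 'cV[R]_n) (A : T -> 'cV[R]_n) : T -> R :=
  fun t => (a^T *m A t) 0 0.

(* The largest canonical correlation of A and B, that is, the largest
   correlation coefficient of linear combinations of their components, is at
   least rho. *)
Definition highly_correlated (rho : R) p q
    (A : T -> 'cV[R]_p) (B : T -> 'cV[R]_q) : Prop :=
  exists (a : 'cV[R]_p) (b : 'cV[R]_q),
    let Aa := linear_comb a A in
    let Bb := linear_comb b B in
    [/\ Aa \in Lfun P 2%:E, Bb \in Lfun P 2%:E,
        (0 < 'V_P[Aa])%E, (0 < 'V_P[Bb])%E &
        (rho%:E * (sqrte 'V_P[Aa] * sqrte 'V_P[Bb]) <= covariance P Aa Bb)%E].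

Definition sigma_of n (A : T -> 'cV[R]_n) : set (set T) :=
  preimage_set_system setT A measurable.

Definition mutually_independent (I : finType) (F : I -> set (set T)) : Prop :=
  forall (K : {set I}) (E : I -> set T), (forall i, i \in K -> F i (E i)) ->
    fine (P (\bigcap_(i in [set` K]) E i)) = \prod_(i in K) fine (P (E i)).

End random_vectors.

(* The nodes are the tuples (i_1, ..., i_k) with 1 <= i_j <= M^(i_1...i_(j-1)):
   the children of I are I.1, ..., I.M^I, hence the shift m.+1. *)
Definition child (I : seq nat) (m : nat) : seq nat := rcons I m.+1.

Inductive node (M : seq nat -> nat) : seq nat -> Prop :=
| node_root : node M [::]
| node_child I (m : 'I_(M I)) : node M I -> node M (child I m).

(* h X - sum_m S m [g m (Uhat m) - g m (U m)] *)
Definition control_variate_relation (T : Type) (R : realType) (n r M : nat)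
    (u k : 'I_M -> nat) (h : 'cV[R]_n -> 'cV[R]_r) (X : T -> 'cV[R]_n)
    (g : forall m, 'cV[R]_(u m) -> 'cV[R]_(k m))
    (Uhat U : forall m, T -> 'cV[R]_(u m)) (S : forall m, 'M[R]_(r, k m)) :
    T -> 'cV[R]_r :=
  fun t => h (X t) - \sum_m S m *m (g m (Uhat m t) - g m (U m t)).

(* All data are indexed by tuples. Values at tuples that are not nodes are
   irrelevant, and so are ctrl, anc and g at the root.
   - dimU J is the dimension of Uhat^J, U^J and Z^J: the first two are arguments
     of the same g^J, and U^J is Z^J at an internal node J.
   - gain J m is S^(J.m), so the gains at node J are a family over its children.
   - The function h may vary with the node, as the dimensions do. *)
Record model_tree (d : measure_display) (T : measurableType d) (R : realType)
    (P : probability T R) := ModelTree {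
  nchild : seq nat -> nat ;
  dimX : seq nat -> nat ;
  dimU : seq nat -> nat ;
  dimG : seq nat -> nat ;
  prin : forall J, {RV P >-> 'cV[R]_(dimX J)} ;
  ctrl : forall J, {RV P >-> 'cV[R]_(dimU J)} ;
  anc : forall J, {RV P >-> 'cV[R]_(dimU J)} ;
  hfun : forall J, {mfun 'cV[R]_(dimX J) >-> 'cV[R]_(dimU J)} ;
  gfun : forall J, {mfun 'cV[R]_(dimU J) >-> 'cV[R]_(dimG J)} ;
  gain : forall J (m : 'I_(nchild J)), 'M[R]_(dimU J, dimG (child J m)) ;
  tree_finite : exists N, forall J, node nchild J -> (size J < N)%N ;
  anc_total : forall J (m : 'I_(nchild J)), node nchild J ->
    let K := child J m in (0 < nchild K)%N ->
    anc K =1 control_variate_relation (hfun K) (prin K)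
      (fun i => gfun (child K i)) (fun i => ctrl (child K i))
      (fun i => anc (child K i)) (@gain K)
}.

Section model_tree_theory.
Context {d : measure_display} {T : measurableType d} {R : realType}
  {P : probability T R}.
Variables (t : model_tree P) (I : seq nat).

Definition gains : Type :=
  forall m : 'I_(nchild t I), 'M[R]_(dimU t I, dimG t (child I m)).

(* h(X^I), g^(I.m)(Uhat^(I.m)) and g^(I.m)(U^(I.m)) *)
Definition hX : T -> 'cV[R]_(dimU t I) := hfun t I \o prin t I.
Definition gUhat (m : 'I_(nchild t I)) : T -> 'cV[R]_(dimG t (child I m)) :=
  gfun t (child I m) \o ctrl t (child I m).
Definition gU (m : 'I_(nchild t I)) : T -> 'cV[R]_(dimG t (child I m)) :=
  gfun t (child I m) \o anc t (child I m).

(* Z^I as a function of the gains at I; the U^(I.m) involve only gains at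
   proper descendants of I, which stay fixed. *)
Definition total_variate (S : gains) : T -> 'cV[R]_(dimU t I) :=
  control_variate_relation (hfun t I) (prin t I)
    (fun m => gfun t (child I m)) (fun m => ctrl t (child I m))
    (fun m => anc t (child I m)) S.

Definition optimal_gains (S : gains) : Prop :=
  forall S' : gains,
    \tr (covmx P (total_variate S) (total_variate S)) <=
    \tr (covmx P (total_variate S') (total_variate S')).

(* Sigma-algebra of the variates on the fidelity of the children of I and above:
   the controls Uhat^(I.m), and the principal and control variates at I and its
   ancestors. The ancillary variates at I and its ancestors are total variates,
   hence functions of the U^(I.m), and cannot be included. *)
Definition sigma_above : set (set T) :=
  <<s (\bigcup_(J in [set J | prefix J I]) sigma_of (prin t J))
      `|` (\bigcup_(J in [set J | prefix J I && (J != [::])])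
             sigma_of (ctrl t J))
      `|` (\bigcup_(m in [set: 'I_(nchild t I)])
             sigma_of (ctrl t (child I m))) >>.

Definition ancillary_independent : Prop :=
  mutually_independent P (fun o : option 'I_(nchild t I) =>
    if o is Some m then sigma_of (anc t (child I m)) else sigma_above).

Definition controls_highly_correlated (rho : R) : Prop :=
  (forall m : 'I_(nchild t I),
     highly_correlated P rho (ctrl t (child I m)) (prin t I)) /\
  (forall m m' : 'I_(nchild t I), m != m' ->
     highly_correlated P rho (ctrl t (child I m)) (ctrl t (child I m'))).

End model_tree_theory.

Arguments gains {d T R P} t I.
Arguments hX {d T R P} t I.
Arguments gUhat {d T R P} t I m.
Arguments gU {d T R P} t I m.
Arguments optimal_gains {d T R P t I} S.
Arguments ancillary_independent {d T R P} t I.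
Arguments controls_highly_correlated {d T R P} t I rho.

(* Main.v *)
Require Import Defs.
From HB Require Import structures.
From mathcomp Require Import all_boot all_order all_algebra.
From mathcomp Require Import all_classical all_reals all_analysis.
From mathcomp Require Import measurable_realfun ring lra.

(* With the W^m := g(Uhat^m) - g(U^m) stacked into one vector W, the total
   variate is the residual h(X) - S W, so the trace of its covariance is a
   quadratic function of S whose Hessian is given by the positive semidefinite
   Sigma_W. Completing the square, S minimizes it iff S Sigma_W = Sigma_(h(X),W);
   this needs no invertibility of Sigma_W. Independence of the ancillary variates
   kills every cross covariance involving some g(U^m), except those of g(U^m)
   with itself, so Sigma_W and Sigma_(h(X),W) are the matrices of the linear
   system. *)

Set Implicit Arguments.
Unset Strict Implicit.
Unset Printing Implicit Defensive.

Import Order.TTheory GRing.Theory Num.Theory.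

Local Open Scope classical_set_scope.
Local Open Scope ring_scope.

(** * Independent square-integrable variables are uncorrelated *)

Section independence.
Context {d : measure_display} {T : measurableType d} {R : realType}.
Variable P : probability T R.

(** The law of [(X, Y)] and the product of the two laws agree on rectangles, hence everywhere by
    uniqueness of product measures; Fubini then gives the iterated integral. *)
Lemma integral_joint_law d1 d2 (T1 : measurableType d1)
    (T2 : measurableType d2) (X : {RV P >-> T1}) (Y : {RV P >-> T2})
    (f : T1 * T2 -> \bar R) :
  (forall A B, measurable A -> measurable B ->
     P (X @^-1` A `&` Y @^-1` B) = (P (X @^-1` A) * P (Y @^-1` B))%E) ->
  measurable_fun setT f ->
  P.-integrable setT (fun t => f (X t, Y t)) ->
  (\int[P]_t f (X t, Y t) =
   \int[distribution P X]_x \int[distribution P Y]_y f (x, y))%E.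
Proof.
move=> XYind mf fXY.
have mXY : measurable_fun setT (fun t => (X t, Y t)).
  exact: measurable_fun_pair.
pose XY : {RV P >-> (T1 * T2)%type} := mfun_Sub (mem_set mXY).
have lawE A : measurable A -> A `<=` setT ->
    (distribution P X \x distribution P Y)%E A = distribution P XY A.
  by move=> mA _; apply: product_measure_unique => // B C mB mC; rewrite -XYind.
(* Change of variables for the nonnegative [|f|] needs no prior integrability, so it can carry
   integrability over to the product law. *)
have fint : (distribution P X \x distribution P Y)%E.-integrable setT f.
  apply/integrableP; split => //.
  rewrite (eq_measure_integral (distribution P XY))//.
  rewrite ge0_integral_distribution//; last exact: measurableT_comp.
  by have /integrableP[] := fXY.
rewrite [RHS](integral12_prod_meas1 fint).
by rewrite (eq_measure_integral (distribution P XY))// integral_distribution.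
Qed.

Lemma expectation_independent (X Y : {RV P >-> measurableTypeR R}) :
  (X : T -> R) \in Lfun P 1 -> (Y : T -> R) \in Lfun P 1 ->
  (X : T -> R) \* Y \in Lfun P 1 ->
  (forall A B, measurable A -> measurable B ->
     P (X @^-1` A `&` Y @^-1` B) = (P (X @^-1` A) * P (Y @^-1` B))%E) ->
  ('E_P[((X : T -> R) \* Y)%R] = 'E_P[X] * 'E_P[Y])%E.
Proof.
move=> X1 Y1 XY1 XYind.
have lawE (Z : {RV P >-> measurableTypeR R}) : (Z : T -> R) \in Lfun P 1 ->
    (\int[distribution P Z]_x (x : R)%:E = 'E_P[Z])%E /\
    (distribution P Z).-integrable setT (fun x : R => x%:E).
  move=> /Lfun1_integrable iZ; split.
    by rewrite integral_distribution// unlock.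
  by apply: (@integrable_pushforward _ _ _ _ R Z (measurable_funPT Z) P _ EFin).
have [EX iX] := lawE X X1; have [EY iY] := lawE Y Y1.
pose f := fun z : measurableTypeR R * measurableTypeR R => (z.1 * z.2)%:E.
have mf : measurable_fun setT f.
  by apply/measurable_EFinP; exact: measurable_funM.
have -> : ('E_P[((X : T -> R) \* Y)%R] = \int[P]_t f (X t, Y t))%E.
  by rewrite unlock.
rewrite (integral_joint_law XYind mf); last by have /Lfun1_integrable := XY1.
rewrite /f/=.
under eq_integral => x _.
  under eq_integral => y _ do rewrite EFinM.
  rewrite (integralZl measurableT iY) EY.
over.
(* The constant ['E_P[Y]] must be seen as a real number before it can leave the outer integral. *)
rewrite -EX -(fineK (expectation_fin_num Y1)).
by rewrite integralZr.
Qed.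

Lemma covariance_independent (X Y : T -> R) :
  X \in Lfun P 2%:E -> Y \in Lfun P 2%:E ->
  (forall A B : set (measurableTypeR R), measurable A -> measurable B ->
     P (X @^-1` A `&` Y @^-1` B) = (P (X @^-1` A) * P (Y @^-1` B))%E) ->
  covariance P X Y = 0%E.
Proof.
move=> X2 Y2 XYind.
have Pfin : P setT \is a fin_num := fin_num_measure P _ measurableT.
have X1 := Lfun_subset12 Pfin X2.
have Y1 := Lfun_subset12 Pfin Y2.
have XY1 := Lfun2_mul_Lfun1 X2 Y2.
have mX : measurable_fun setT (X : T -> measurableTypeR R).
  exact: set_mem (sub_Lfun_mfun X2).
have mY : measurable_fun setT (Y : T -> measurableTypeR R).
  exact: set_mem (sub_Lfun_mfun Y2).
pose X' : {RV P >-> measurableTypeR R} :=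
  @mfun_Sub _ _ T (measurableTypeR R) X (mem_set mX).
pose Y' : {RV P >-> measurableTypeR R} :=
  @mfun_Sub _ _ T (measurableTypeR R) Y (mem_set mY).
rewrite covarianceE// (@expectation_independent X' Y')// subee//.
by rewrite fin_numM// expectation_fin_num.
Qed.

End independence.

(** This trace is the sum of the squares of all entries of [E]. *)
Lemma mxtrace_mul_tr_eq0 (R : realDomainType) (m n : nat) (E : 'M[R]_(m, n)) :
  \tr (E *m E^T) = 0 -> E = 0.
Proof.
have E2 i j : 0 <= E i j * E^T j i by rewrite mxE -expr2 sqr_ge0.
move=> q0; apply/matrixP => i j; rewrite [RHS]mxE.
have EE_ge0 k : true -> 0 <= (E *m E^T) k k by rewrite mxE sumr_ge0.
have : (E *m E^T) i i = 0 by exact: (psumr_eq0P EE_ge0 q0).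
rewrite mxE => rowE.
have : E i j * E^T j i = 0 by exact: (psumr_eq0P (fun k _ => E2 i k) rowE).
by rewrite mxE -expr2 => /eqP; rewrite sqrf_eq0 => /eqP.
Qed.

(** * Bilinearity of covariance matrices *)

Section covmx.
Context {d : measure_display} {T : measurableType d} {R : realType}.
Variable P : probability T R.

Local Notation cov X Y := (fine (covariance P X Y)).

Lemma Lfun2_covariance_fin_num (X Y : T -> R) :
  X \in Lfun P 2%:E -> Y \in Lfun P 2%:E -> covariance P X Y \is a fin_num.
Proof.
move=> X2 Y2; have Pfin := fin_num_measure P _ measurableT.
by rewrite covariance_fin_num ?Lfun2_mul_Lfun1 ?(Lfun_subset12 Pfin).
Qed.

Let sum_scale_funE (I : finType) (a : I -> R) (X : I -> T -> R) :
  (fun t => \sum_i a i * X i t) = \sum_i (a i \o* X i).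
Proof.
apply/funext => t; rewrite fct_sumE.
by apply: eq_bigr => i _ /=; rewrite mulrC.
Qed.

Lemma Lfun2_suml (I : finType) (a : I -> R) (X : I -> T -> R) :
  (forall i, X i \in Lfun P 2%:E) ->
  (fun t => \sum_i a i * X i t) \in Lfun P 2%:E.
Proof.
move=> X2.
rewrite sum_scale_funE.
apply: rpred_sum; first by rewrite lee_fin ler1n.
move=> ? i _; apply: Lfun_scale; last exact: X2.
by rewrite ler1n.
Qed.

Lemma fine_covariance_suml (I : finType) (a : I -> R) (X : I -> T -> R) Y :
  (forall i, X i \in Lfun P 2%:E) -> Y \in Lfun P 2%:E ->
  cov (fun t => \sum_i a i * X i t) Y = \sum_i a i * cov (X i) Y.
Proof.
move=> X2 Y2; have Pfin := fin_num_measure P _ measurableT.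
have le12 : (1 <= 2 :> R) by rewrite ler1n.
rewrite sum_scale_funE.
(* Additivity of the covariance requires the partial sums to be square integrable, so the induction
   carries this fact along. *)
suff [] : (\sum_i (a i \o* X i) \in Lfun P 2%:E) /\
    cov (\sum_i (a i \o* X i)) Y = \sum_i a i * cov (X i) Y by [].
elim/big_rec2: _ => [|i s f _ [f2 IH]].
  split; first by rewrite rpred0.
  by rewrite (covariance_cst_l P 0).
have aX2 : a i \o* X i \in Lfun P 2%:E by exact: Lfun_scale.
split; first by rewrite rpredD.
rewrite covarianceDl// fineD ?Lfun2_covariance_fin_num// IH; congr (_ + _).
rewrite covarianceZl ?Lfun2_mul_Lfun1 ?(Lfun_subset12 Pfin)//.
by rewrite fineM// Lfun2_covariance_fin_num.
Qed.

Lemma square_integrable_mulmx p q (S : 'M[R]_(p, q)) (A : T -> 'cV[R]_q) :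
  square_integrable P A -> square_integrable P (fun t => S *m A t).
Proof.
move=> A2 i; under eq_fun do rewrite mxE.
exact: (Lfun2_suml (S i) A2).
Qed.

Lemma square_integrableB p (A B : T -> 'cV[R]_p) :
  square_integrable P A -> square_integrable P B ->
  square_integrable P (fun t => A t - B t).
Proof.
move=> A2 B2 i; under eq_fun do rewrite mxE [(- _ : 'cV_p) _ _]mxE.
rewrite -[X in X \in _]/((fun t => A t i 0) \- (fun t => B t i 0)).
by rewrite rpredB// lee_fin ler1n.
Qed.

Lemma trmx_covmx p q (A : T -> 'cV[R]_p) (B : T -> 'cV[R]_q) :
  (covmx P A B)^T = covmx P B A.
Proof. by apply/matrixP => i j; rewrite !mxE covarianceC. Qed.

Lemma covmxMl p q r (S : 'M[R]_(r, p)) (A : T -> 'cV[R]_p) (B : T -> 'cV[R]_q) :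
  square_integrable P A -> square_integrable P B ->
  covmx P (fun t => S *m A t) B = S *m covmx P A B.
Proof.
move=> A2 B2; apply/matrixP => i j; rewrite !mxE.
under eq_fun do rewrite mxE.
rewrite fine_covariance_suml//.
by apply: eq_bigr => k _; rewrite mxE.
Qed.

Lemma covmxMr p q r (S : 'M[R]_(r, q)) (A : T -> 'cV[R]_p) (B : T -> 'cV[R]_q) :
  square_integrable P A -> square_integrable P B ->
  covmx P A (fun t => S *m B t) = covmx P A B *m S^T.
Proof.
by move=> A2 B2; rewrite -trmx_covmx covmxMl// trmx_mul trmx_covmx.
Qed.

Lemma covmxBl p q (A B : T -> 'cV[R]_p) (C : T -> 'cV[R]_q) :
  square_integrable P A -> square_integrable P B -> square_integrable P C ->
  covmx P (fun t => A t - B t) C = covmx P A C - covmx P B C.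
Proof.
move=> A2 B2 C2; apply/matrixP => i j; rewrite !mxE.
under eq_fun do rewrite mxE [(- _ : 'cV_p) _ _]mxE.
rewrite (covarianceBl (A2 i) (B2 i) (C2 j)).
by rewrite fineB// Lfun2_covariance_fin_num.
Qed.

Lemma covmxBr p q (A : T -> 'cV[R]_p) (B C : T -> 'cV[R]_q) :
  square_integrable P A -> square_integrable P B -> square_integrable P C ->
  covmx P A (fun t => B t - C t) = covmx P A B - covmx P A C.
Proof.
by move=> A2 B2 C2; rewrite -trmx_covmx covmxBl// raddfB/= !trmx_covmx.
Qed.

Lemma mxtrace_covmx_ge0 p (A : T -> 'cV[R]_p) : 0 <= \tr (covmx P A A).
Proof.
apply: sumr_ge0 => i _; rewrite mxE; apply: fine_ge0.
exact: variance_ge0.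
Qed.

(** * Least-squares minimization of the trace of a residual covariance *)

Section residual.
Variables (r k : nat) (X : T -> 'cV[R]_r) (W : T -> 'cV[R]_k).
Hypotheses (X2 : square_integrable P X) (W2 : square_integrable P W).

Let Z (S : 'M[R]_(r, k)) := fun t => X t - S *m W t.
Let J S := \tr (covmx P (Z S) (Z S)).

(** This is the exact second-order expansion of [J] at [S]: [2 * (S *m covmx P W W - covmx P X W)]
    is the gradient, and the part quadratic in [D] is the variance of [D *m W]. *)
Lemma mxtrace_covmx_residualB S D :
  J (S - D) = J S + (\tr (D *m covmx P W W *m D^T)
                     - 2 * \tr ((S *m covmx P W W - covmx P X W) *m D^T)).
Proof.
have Z2 S' : square_integrable P (Z S').
  by apply: square_integrableB => //; exact: square_integrable_mulmx.
have D2 := square_integrable_mulmx D W2.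
have S2 := square_integrable_mulmx S W2.
have ZE : Z (S - D) = fun t => Z S t - (- D) *m W t.
  by apply/funext => t; rewrite /Z mulmxBl mulNmx opprB opprK addrA addrAC.
have N2 : square_integrable P (fun t => - D *m W t).
  exact: square_integrable_mulmx.
have ZW : covmx P (Z S) W = - (S *m covmx P W W - covmx P X W).
  by rewrite covmxBl// covmxMl// opprB.
have WZ : \tr (covmx P (fun t => - D *m W t) (Z S)) =
    \tr ((S *m covmx P W W - covmx P X W) *m D^T).
  by rewrite -mxtrace_tr trmx_covmx covmxMr// ZW linearN/= mulmxN mulNmx opprK.
rewrite /J ZE (covmxBl (Z2 S) N2 (square_integrableB (Z2 S) N2)).
rewrite (covmxBr (Z2 S) (Z2 S) N2) (covmxBr N2 (Z2 S) N2).
(* The two cross terms are transposes of each other, hence have the same trace. *)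
rewrite !raddfB/= WZ -{1}[covmx P (Z S) (fun t => - D *m W t)]trmxK.
rewrite mxtrace_tr trmx_covmx WZ covmxMl// covmxMr//.
have -> : (- D)^T = - D^T by exact: raddfN.
rewrite !mulmxN !mulNmx opprK mulmxA.
lra.
Qed.

Lemma residual_minimizerP S :
  (forall S', J S <= J S') <-> S *m covmx P W W = covmx P X W.
Proof.
split=> [Smin|SE S'].
  set E := S *m covmx P W W - covmx P X W.
  pose q := \tr (E *m E^T); pose c := \tr (E *m covmx P W W *m E^T).
  (* [c] is the trace of the covariance of [E *m W]. *)
  have c_ge0 : 0 <= c.
    rewrite /c -mulmxA -covmxMr// -covmxMl//;
      last exact: square_integrable_mulmx.
    exact: mxtrace_covmx_ge0.
  (* Along the gradient E, the step q / (c + 1) would lower the trace by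
     q^2 u (1 + u) if q were nonzero. *)
  pose u := (c + 1)^-1.
  have u_gt0 : 0 < u by rewrite invr_gt0 ltr_wpDl.
  have cu : c * u = 1 - u.
    have : (c + 1) * u = 1 by rewrite divff// gt_eqF// ltr_wpDl.
    lra.
  have := Smin (S - (q * u) *: E).
  rewrite mxtrace_covmx_residualB -/E linearZ/= -!scalemxAr -!scalemxAl.
  rewrite !mxtraceZ.
  rewrite -/q -/c lerDl => le0.
  have q0 : q = 0.
    have : 0 <= - (q ^+ 2 * (u * (1 + u))).
      apply: le_trans le0 _; rewrite -subr_ge0.
      have -> : q * u * (q * u * c) = q ^+ 2 * u * (c * u) by ring.
      by rewrite cu; lra.
    have u1 : 0 < u * (1 + u) by rewrite mulr_gt0// addr_gt0.
    rewrite oppr_ge0 pmulr_lle0// => q2.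
    by apply/eqP; rewrite -sqrf_eq0 eq_le q2 sqr_ge0.
  by apply/eqP; rewrite -subr_eq0 -/E (mxtrace_mul_tr_eq0 q0).
(* Conversely, at a critical point the linear term vanishes and what remains is the trace of the
   covariance of [(S - S') *m W]. *)
have -> : S' = S - (S - S') by rewrite opprB addrC subrK.
rewrite mxtrace_covmx_residualB SE subrr mul0mx mxtrace0 mulr0 subr0 lerDl.
rewrite -mulmxA -covmxMr// -covmxMl//; last exact: square_integrable_mulmx.
exact: mxtrace_covmx_ge0.
Qed.

End residual.

End covmx.

(** * Covariance matrices of stacked vectors *)

Section covmx_mxcol.
Context {d : measure_display} {T : measurableType d} {R : realType}.
Variable P : probability T R.
Variables (k : nat) (q_ : 'I_k -> nat).

Lemma square_integrable_mxcol (A_ : forall i, T -> 'cV[R]_(q_ i)) :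
  (forall i, square_integrable P (A_ i)) ->
  square_integrable P (fun t => \mxcol_i A_ i t).
Proof. by move=> A2 s; under eq_fun do rewrite mxE; exact: A2. Qed.

Lemma covmx_mxcolr p (A : T -> 'cV[R]_p) (B_ : forall i, T -> 'cV[R]_(q_ i)) :
  covmx P A (fun t => \mxcol_i B_ i t) = \mxrow_i covmx P A (B_ i).
Proof.
apply/matrixP => i s; rewrite !mxE; congr (fine (covariance P _ _)).
by apply/funext => t; rewrite mxE.
Qed.

Lemma covmx_mxcol (A_ B_ : forall i, T -> 'cV[R]_(q_ i)) :
  covmx P (fun t => \mxcol_i A_ i t) (fun t => \mxcol_i B_ i t) =
  \mxblock_(i, j) covmx P (A_ i) (B_ j).
Proof.
rewrite covmx_mxcolr mxblockEh; apply: eq_mxrow => j.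
rewrite -trmx_covmx covmx_mxcolr tr_mxrow.
by apply: eq_mxcol => i; rewrite trmx_covmx.
Qed.

End covmx_mxcol.

(** * Vanishing cross covariances under independence *)

Section covmx_independent.
Context {d : measure_display} {T : measurableType d} {R : realType}.
Variable P : probability T R.

Lemma measurable_coord n (i : 'I_n) :
  measurable_fun setT (fun v : 'cV[R]_n => v i 0 : measurableTypeR R).
Proof.
move=> _ Y mY; rewrite setTI; apply: sub_sigma_algebra => /=.
rewrite -bigcup_seq/=; exists i => /=; first by rewrite mem_index_enum.
by exists Y => //; rewrite setTI.
Qed.

(** This passes independence from the variates to their images under the nonlinear maps [h] and
    [g]. *)
Lemma sigma_of_comp m n (f : 'cV[R]_m -> 'cV[R]_n) (A : T -> 'cV[R]_m) :
  measurable_fun setT f -> sigma_of (f \o A) `<=` sigma_of A.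
Proof. by move=> mf; exact: preimage_set_system_compS. Qed.

Lemma mutually_independent2 (I : finType) (F : I -> set (set T)) i j A B :
  mutually_independent P F -> i != j -> F i A -> F j B ->
  measurable A -> measurable B -> P (A `&` B) = (P A * P B)%E.
Proof.
move=> Find ij FA FB mA mB.
pose E k := if k == i then A else B.
have EF k : k \in [set i; j]%SET -> F k (E k).
  by rewrite !inE /E => /orP[]/eqP-> //; rewrite ?eqxx// eq_sym (negbTE ij).
have := Find _ E EF.
rewrite big_setU1 ?inE//= big_set1 /E eqxx eq_sym (negbTE ij).
have -> : \bigcap_(k in [set` [set i; j]%SET]) E k = A `&` B.
  apply/seteqP; split=> [t Et|t [At Bt] k /=].
    split; first by have := Et i; rewrite /= !inE /E eqxx; apply.
    by have := Et j; rewrite /= !inE /E eqxx orbT eq_sym (negbTE ij); apply.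
  by rewrite !inE /E; case: eqP.
(* Mutual independence is stated for real values of [P]; finiteness of [P] on measurable sets lifts
   it to the extended reals. *)
move=> PE; have mAB : measurable (A `&` B) by exact: measurableI.
rewrite -[LHS]fineK ?fin_num_measure// PE EFinM.
by rewrite !fineK ?fin_num_measure.
Qed.

(** Entrywise, events on a coordinate of [A] lie in [F i] and those on a coordinate of [B] in [F j],
    so the coordinates are independent. *)
Lemma covmx_independent (I : finType) (F : I -> set (set T)) i j p q
    (A : T -> 'cV[R]_p) (B : T -> 'cV[R]_q) :
  mutually_independent P F -> i != j ->
  sigma_of A `<=` F i -> sigma_of B `<=` F j ->
  square_integrable P A -> square_integrable P B -> covmx P A B = 0.
Proof.
move=> Find ij FA FB A2 B2; apply/matrixP => a b; rewrite !mxE.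
rewrite covariance_independent// => C D mC mD.
have sigma_coord n (Z : T -> 'cV[R]_n) (c : 'I_n) G :
    measurable G -> sigma_of Z ((fun t => Z t c 0 : measurableTypeR R) @^-1` G).
  move=> mG; exists ((fun v : 'cV[R]_n => v c 0) @^-1` G);
    last by rewrite setTI.
  by rewrite -[X in measurable X]setTI; exact: measurable_coord.
(* The sets in [F i] are not assumed measurable; measurability comes from membership in [Lfun]. *)
have mcoord n (Z : T -> 'cV[R]_n) (c : 'I_n) G : square_integrable P Z ->
    measurable G -> measurable ((fun t => Z t c 0 : measurableTypeR R) @^-1` G).
  move=> Z2 mG; rewrite -[X in measurable X]setTI.
  exact: (set_mem (sub_Lfun_mfun (Z2 c))).
apply: (mutually_independent2 Find ij).
- exact/FA/sigma_coord.
- exact/FB/sigma_coord.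
- exact: mcoord.
- exact: mcoord.
Qed.

End covmx_independent.

Theorem theorem3p1 (d : measure_display) (T : measurableType d) (R : realType)
    (P : probability T R) (t : model_tree P) (I : seq nat) (rho : R)
    (nodeI : node (nchild t) I)
    (hX2 : square_integrable P (hX t I))
    (gUhat2 : forall m, square_integrable P (gUhat t I m))
    (gU2 : forall m, square_integrable P (gU t I m))
    (rho_gt0 : 0 < rho)
    (corr : controls_highly_correlated t I rho)
    (indep : ancillary_independent t I)
    (S : gains t I) :
  optimal_gains S <->
  (\mxrow_m S m) *m
    (\mxblock_(i, j) (covmx P (gUhat t I i) (gUhat t I j) +
                      (if i == j then covmx P (gU t I i) (gU t I j) else 0)))
  = \mxrow_m covmx P (hX t I) (gUhat t I m).
Proof.
pose D m := fun s => gUhat t I m s - gU t I m s.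
pose W s := \mxcol_m D m s.
have D2 m : square_integrable P (D m) by exact: square_integrableB.
have W2 : square_integrable P W by exact: square_integrable_mxcol.
have gU_sigma m : sigma_of (gU t I m) `<=` sigma_of (anc t (child I m)).
  exact: sigma_of_comp.
(* [I] is a prefix of itself, so its own principal variate is among the generators. *)
have hX_sigma : sigma_of (hX t I) `<=` sigma_above t I.
  apply: subset_trans (@sub_sigma_algebra _ _ _) => A /(sigma_of_comp _) hA.
  by left; left; exists I; [exact: prefix_refl|exact: hA].
have gUhat_sigma m : sigma_of (gUhat t I m) `<=` sigma_above t I.
  apply: subset_trans (@sub_sigma_algebra _ _ _) => A /(sigma_of_comp _) hA.
  by right; exists m => //; exact: hA.
(* In [indep], the index [None] stands for [sigma_above] and [Some m] for the ancillary variate of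
   child [m]. *)
have cov_hX_gU m : covmx P (hX t I) (gU t I m) = 0.
  exact: (covmx_independent (i := None) (j := Some m) indep).
have cov_gUhat_gU m m' : covmx P (gUhat t I m) (gU t I m') = 0.
  exact: (covmx_independent (i := None) (j := Some m') indep).
have cov_gU m m' : m != m' -> covmx P (gU t I m) (gU t I m') = 0.
  move=> mm'; exact: (covmx_independent (i := Some m) (j := Some m') indep).
have covXW : covmx P (hX t I) W = \mxrow_m covmx P (hX t I) (gUhat t I m).
  rewrite covmx_mxcolr; apply: eq_mxrow => m.
  by rewrite covmxBr// cov_hX_gU subr0.
have covWW : covmx P W W =
    \mxblock_(i, j) (covmx P (gUhat t I i) (gUhat t I j) +
                     (if i == j then covmx P (gU t I i) (gU t I j) else 0)).
  rewrite covmx_mxcol; apply: eq_mxblock => i j.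
  rewrite covmxBl// !covmxBr// cov_gUhat_gU subr0.
  rewrite -[covmx P (gU t I i) (gUhat t I j)]trmx_covmx cov_gUhat_gU trmx0.
  (* The two minus signs in front of the ancillary covariance cancel; off the diagonal it vanishes
     by independence. *)
  by rewrite sub0r opprK; case: eqVneq => // /cov_gU ->.
have ZE S' : total_variate S' = fun s => hX t I s - \mxrow_m S' m *m W s.
  by apply/funext => s; rewrite mul_mxrow_mxcol.
rewrite -covWW -covXW -(residual_minimizerP hX2 W2); split=> Smin S'.
  (* The residual problem ranges over whole matrices; cutting one into blocks with [submxrow] gives
     a family of gains to compare with. *)
  by have := Smin (submxrow S'); rewrite !ZE submxrowK.
by rewrite !ZE; exact: Smin.
Qed.
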